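(* $\langle\vee\forall\rangle\not\le_{\sf m}\langle\forall^\infty\forall\exists\rangle$.
   Context: Quantifiers range over $\omega$. $\exists^\infty n\,\varphi(n)$ means $\forall m\exists n\ge m\,\varphi(n)$ and $\forall^\infty n\,\varphi(n)$ means $\exists m\forall n\ge m\,\varphi(n)$. Formulas considered are $\varphi(\bar x)\equiv\mathsf Q_0n_0\dots\mathsf Q_\ell n_\ell\,\theta(n_0,\dots,n_\ell,\bar x)$ with $\mathsf Q_i\in\{\exists,\forall,\exists^\infty,\forall^\infty\}$ and $\theta$ bounded. The instance $\bar x$ is a tuple of natural numbers and/or total computable functions (computable elements of $\omega^\omega$). Spaces such as $\omega\times\omega^\omega$, $(\omega^\omega)^\omega$, $\omega^{\omega\times\omega}$ are identified with $\omega^\omega$ by computable pairing. Witnesses: for $\alpha\in\omega^\omega$, $\alpha\Vdash\varphi(\bar x)$ (''$\alpha$ is a witness for $\varphi(\bar x)$'') is defined by: $\alpha\Vdash\theta(\bar x)$ iff $\alpha=\bar x$ and $\theta(\bar x)$, for bounded $\theta$; $\langle t,\alpha\rangle\Vdash\exists n\varphi(n,\bar x)$ iff $\alpha\Vdash\varphi(t,\bar x)$; $\alpha\Vdash\forall n\varphi(n,\bar x)$ iff $\alpha(n)\Vdash\varphi(n,\bar x)$ for all $n$; $\langle t,\alpha\rangle\Vdash\forall^\infty n\varphi(n,\bar x)$ iff $\alpha(n)\Vdash\varphi(n,\bar x)$ for all $n\ge t$; $\alpha\Vdash\exists^\infty n\varphi(n,\bar x)$ iff for all $n$, writing $\alpha(n)=\langle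 k,\beta\rangle$, $k\ge n$ and $\beta\Vdash\varphi(k,\bar x)$. $\varphi\le_{\sf m}\psi$ if there are computable functions $\eta,r_-,r_+$ (type-two computable functionals, possibly partial but defined wherever required) such that for every instance $\bar x$: $\varphi(\bar x)$ is true iff $\psi(\eta(\bar x))$ is true; $\alpha\Vdash\varphi(\bar x)$ implies $r_-(\alpha,\bar x)\Vdash\psi(\eta(\bar x))$; $\alpha\Vdash\psi(\eta(\bar x))$ implies $r_+(\alpha,\bar x)\Vdash\varphi(\bar x)$ ($\alpha\in\omega^\omega$ arbitrary). $\langle\forall^\infty\forall\exists\rangle$ is a fixed complete formula of its pattern (every formula with that pattern is $\le_{\sf m}$-reducible to it), concretely $\langle\forall^\infty\forall\exists\rangle(x)\equiv\forall^\infty n\,\forall k\,\exists\ell.\ x(n,k,\ell)=0$. The formula $\langle\vee\forall\rangle$ is, for $x=(x_0,x_1)$ with $x_0,x_1\in\omega^\omega$ computable, $x_0=0^\infty\vee x_1=0^\infty$, read as $\exists i\in\{0,1\}\,\forall t.\ x_i(t)=0$; so a witness is essentially an $i\in\{0,1\}$ with $x_i=0^\infty$, where $0^\infty$ is the constantly zero sequence. *)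

(* Defs.v *)
From Stdlib Require Import Arith List Cantor.
Import ListNotations.

Set Implicit Arguments.
Unset Strict Implicit.
Unset Printing Implicit Defensive.

Definition Baire := nat -> nat.

Definition npair (n m : nat) : nat := Cantor.to_nat (n, m).
Definition nleft (k : nat) : nat := fst (Cantor.of_nat k).
Definition nright (k : nat) : nat := snd (Cantor.of_nat k).

(* Unary partial recursive functions over the pairing function; since pairing
   is bijective, these codes present all partial recursive functions. *)
Inductive code : Type :=
| czero
| csucc
| cleft
| cright
| coracle
| cpair (f g : code)
| ccomp (f g : code)
| cprec (f g : code)
| cmu (f : code).

(* [eval a c n m]: the program [c] with oracle [a] halts on [n] with output
   [m].  [cprec f g] maps (u, 0) to f u and (u, k+1) to
   g (u, (k, value at (u, k))); [cmu f] maps u to the least m with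
   f (u, m) = 0, provided f converges on all smaller arguments. *)
Fixpoint eval (a : Baire) (c : code) (n m : nat) {struct c} : Prop :=
  match c with
  | czero => m = 0
  | csucc => m = S n
  | cleft => m = nleft n
  | cright => m = nright n
  | coracle => m = a n
  | cpair f g => eval a f n (nleft m) /\ eval a g n (nright m)
  | ccomp f g => exists k, eval a g n k /\ eval a f k m
  | cprec f g =>
      (fix iter (k y : nat) {struct k} : Prop :=
         match k with
         | 0 => eval a f (nleft n) y
         | S k' => exists z, iter k' z /\
                     eval a g (npair (nleft n) (npair k' z)) y
         end) (nright n) m
  | cmu f =>
      eval a f (npair n m) 0 /\
      forall k, k < m -> exists v, eval a f (npair n k) (S v)
  end.

(* A code [c], with its oracle as the argument, is a partial type-two
   functional: [computes c a b] says that it is defined at [a] with value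
   [b]. *)
Definition computes (c : code) (a b : Baire) : Prop :=
  forall n, eval a c n (b n).

Definition zeros : Baire := fun _ => 0.

Definition computable (a : Baire) : Prop := exists c, computes c zeros a.

(* omega x Baire: the pair <t, alpha> is the sequence t, alpha 0, alpha 1, ... *)
Definition bcons (t : nat) (a : Baire) : Baire :=
  fun n => match n with 0 => t | S k => a k end.
Definition bhead (a : Baire) : nat := a 0.
Definition btail (a : Baire) : Baire := fun n => a (S n).

(* Baire^omega: the n-th component of alpha. *)
Definition bproj (a : Baire) (n : nat) : Baire := fun m => a (npair n m).

(* Baire x Baire: even and odd positions. *)
Definition bjoin (a b : Baire) : Baire :=
  fun n => if Nat.even n then a (Nat.div2 n) else b (Nat.div2 n).

Inductive sort : Type := Num | Fun.

Definition elt (s : sort) : Type :=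
  match s with Num => nat | Fun => Baire end.

Fixpoint tuple (G : list sort) : Type :=
  match G with
  | [] => unit
  | s :: G' => (elt s * tuple G')%type
  end.

Fixpoint encode (G : list sort) : tuple G -> Baire :=
  match G return tuple G -> Baire with
  | [] => fun _ => zeros
  | Num :: G' => fun x => bcons (fst x) (encode (snd x))
  | Fun :: G' => fun x => bjoin (fst x) (encode (snd x))
  end.

Definition is_instance (G : list sort) (x : tuple G) : Prop :=
  computable (encode x).

Inductive var : list sort -> sort -> Type :=
| vz (G : list sort) (s : sort) : var (s :: G) s
| vs (G : list sort) (s s' : sort) (v : var G s) : var (s' :: G) s.

Arguments vz {G s}.
Arguments vs {G s s'} v.

Fixpoint lookup (G : list sort) (s : sort) (v : var G s) : tuple G -> elt s :=
  match v in var G s return tuple G -> elt s with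
  | vz => fun x => fst x
  | vs v' => fun x => lookup v' (snd x)
  end.

(* The pairing symbol has a bounded graph in 0, S, +, *; it lets a function
   of several arguments be applied, as x(n,k,l) = x(<n,<k,l>>). *)
Inductive term (G : list sort) : Type :=
| tvar (v : var G Num)
| tzero
| tsucc (t : term G)
| tadd (t u : term G)
| tmul (t u : term G)
| tpair (t u : term G)
| tapp (f : var G Fun) (t : term G).

Arguments tzero {G}.

Fixpoint tval (G : list sort) (t : term G) (x : tuple G) : nat :=
  match t with
  | tvar v => lookup v x
  | tzero => 0
  | tsucc t => S (tval t x)
  | tadd t u => tval t x + tval u x
  | tmul t u => tval t x * tval u x
  | tpair t u => npair (tval t x) (tval u x)
  | tapp f t => lookup f x (tval t x)
  end.

Inductive bounded : list sort -> Type :=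
| beq (G : list sort) (t u : term G) : bounded G
| blt (G : list sort) (t u : term G) : bounded G
| bnot (G : list sort) (p : bounded G) : bounded G
| band (G : list sort) (p q : bounded G) : bounded G
| bor (G : list sort) (p q : bounded G) : bounded G
| bex (G : list sort) (t : term G) (p : bounded (Num :: G)) : bounded G
| ball (G : list sort) (t : term G) (p : bounded (Num :: G)) : bounded G.

Fixpoint bholds (G : list sort) (p : bounded G) : tuple G -> Prop :=
  match p in bounded G return tuple G -> Prop with
  | beq t u => fun x => tval t x = tval u x
  | blt t u => fun x => tval t x < tval u x
  | bnot p => fun x => ~ bholds p x
  | band p q => fun x => bholds p x /\ bholds q x
  | bor p q => fun x => bholds p x \/ bholds q x
  | @bex G t p => fun x =>
      exists n : nat, n < tval t x /\ @bholds (Num :: G) p (n, x)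
  | @ball G t p => fun x =>
      forall n : nat, n < tval t x -> @bholds (Num :: G) p (n, x)
  end.

Inductive quantifier : Type := QEx | QAll | QExInf | QAllInf.

(* The variable bound by a quantifier is put in front of the tuple, so that
   [quant q phi] is Q n. phi(n, x). *)
Inductive formula : list sort -> Type :=
| matrix (G : list sort) (p : bounded G) : formula G
| quant (G : list sort) (q : quantifier) (phi : formula (Num :: G)) : formula G.

Fixpoint holds (G : list sort) (phi : formula G) : tuple G -> Prop :=
  match phi in formula G return tuple G -> Prop with
  | matrix p => fun x => bholds p x
  | @quant G q phi => fun x =>
      let P (n : nat) := @holds (Num :: G) phi (n, x) in
      match q with
      | QEx => exists n, P n
      | QAll => forall n, P n
      | QExInf => forall m, exists n, m <= n /\ P n
      | QAllInf => exists m, forall n, m <= n -> P n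
      end
  end.

Fixpoint witness (G : list sort) (phi : formula G) : Baire -> tuple G -> Prop :=
  match phi in formula G return Baire -> tuple G -> Prop with
  | matrix p => fun a x => (forall n, a n = encode x n) /\ bholds p x
  | @quant G q phi => fun a x =>
      let W (b : Baire) (n : nat) := @witness (Num :: G) phi b (n, x) in
      match q with
      | QEx => W (btail a) (bhead a)
      | QAll => forall n, W (bproj a n) n
      | QExInf => forall n,
          n <= bhead (bproj a n) /\ W (btail (bproj a n)) (bhead (bproj a n))
      | QAllInf => forall n, bhead a <= n -> W (bproj (btail a) n) n
      end
  end.

Definition le_m (G D : list sort) (phi : formula G) (psi : formula D) : Prop :=
  exists eta rminus rplus : code,
  forall x : tuple G, is_instance x ->
  exists y : tuple D,
    is_instance y /\ computes eta (encode x) (encode y) /\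
    (holds phi x <-> holds psi y) /\
    (forall a : Baire, witness phi a x ->
       exists b, computes rminus (bjoin a (encode x)) b /\ witness psi b y) /\
    (forall a : Baire, witness psi a y ->
       exists b, computes rplus (bjoin a (encode x)) b /\ witness phi b x).

(* In the matrix the free variables are, in order, t, i, x_0, x_1. *)
Definition or_forall : formula [Fun; Fun] :=
  quant QEx (quant QAll (matrix
    (let t := vz in let i := vs vz in
     let x0 := vs (vs vz) in let x1 := vs (vs (vs vz)) in
     bor (band (beq (tvar i) tzero) (beq (tapp x0 (tvar t)) tzero))
         (band (beq (tvar i) (tsucc tzero)) (beq (tapp x1 (tvar t)) tzero))))).

(* In the matrix the free variables are, in order, l, k, n, x. *)
Definition allinf_forall_exists : formula [Fun] :=
  quant QAllInf (quant QAll (quant QEx (matrix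
    (let l := vz in let k := vs vz in
     let n := vs (vs vz) in let x := vs (vs (vs vz)) in
     beq (tapp x (tpair (tvar n) (tpair (tvar k) (tvar l)))) tzero)))).

Lemma holds_or_forall (x0 x1 : Baire) :
  holds or_forall (x0, (x1, tt)) <->
  (forall t, x0 t = 0) \/ (forall t, x1 t = 0).
Proof.
  simpl; split.
  - intros [[|[|i]] H].
    + left; intros t; destruct (H t); intuition discriminate.
    + right; intros t; destruct (H t); intuition discriminate.
    + destruct (H 0); intuition discriminate.
  - intros [H|H]; [exists 0 | exists 1]; intros t; rewrite (H t); auto.
Qed.

Lemma holds_allinf_forall_exists (x : Baire) :
  holds allinf_forall_exists (x, tt) <->
  exists m, forall n, m <= n ->
    forall k, exists l, x (npair n (npair k l)) = 0.
Proof. reflexivity. Qed.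

(* Main.v *)
(** Let [x = (0, 0)], whose disjunction has both the witnesses 0 and 1, and
    let [m] bound the thresholds that [rminus] assigns to these two witnesses.
    Feed [rplus] a witness of the image of [x] with threshold [m]: after reading
    finitely many values it answers some [i].  Now make the [i]-th component of
    [x] nonzero at a late position.  The other component is still zero, so by
    continuity of [rminus] the perturbed image still has a witness with
    threshold [m], and by continuity of [eta] it may be chosen to agree with
    the old one on the part that [rplus] read.  So [rplus] still answers [i],
    which is now wrong. *)

Require Import Defs.
From Stdlib Require Import Arith List Cantor Lia.
Import ListNotations.

(** * Continuity of oracle computations *)

Definition agree (N : nat) (a b : Baire) : Prop := forall n, n < N -> a n = b n.

(** Moduli of continuity are phrased through large [M], so that they combine by conjunction without
    being computed. *)
Definition eventually (P : nat -> Prop) : Prop :=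
  exists N, forall M, N <= M -> P M.

Lemma eventually_and (P Q : nat -> Prop) :
  eventually P -> eventually Q -> eventually (fun M => P M /\ Q M).
Proof.
  intros [N1 H1] [N2 H2]; exists (N1 + N2); intros M HM.
  split; [apply H1 | apply H2]; lia.
Qed.

Lemma eventually_impl (P Q : nat -> Prop) :
  (forall M, P M -> Q M) -> eventually P -> eventually Q.
Proof. intros H [N HN]; exists N; auto. Qed.

Lemma eventually_ge (N : nat) : eventually (fun M => N <= M).
Proof. exists N; auto. Qed.

Lemma eventually_forall_lt (P : nat -> nat -> Prop) (N : nat) :
  (forall n, n < N -> eventually (P n)) ->
  eventually (fun M => forall n, n < N -> P n M).
Proof.
  induction N as [|N IH]; intros H.
  - exists 0; lia.
  - assert (H1 : eventually (fun M => forall n, n < N -> P n M)) by auto.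
    assert (H2 : eventually (P N)) by auto.
    refine (eventually_impl _ _ _ (eventually_and _ _ H1 H2)).
    intros M [HM1 HM2] n Hn.
    destruct (Nat.eq_dec n N) as [->|]; [assumption | apply HM1; lia].
Qed.

(** A halting computation queries only finitely many oracle positions. By induction on the code; for
    [cmu], finitely many searched arguments contribute. *)
Lemma eval_continuous (a : Baire) (c : code) (n m : nat) :
  eval a c n m ->
  eventually (fun M => forall a', agree M a a' -> eval a' c n m).
Proof.
  revert n m; induction c; intros n m; simpl; try (intros ->; exists 0; auto; fail).
  - intros ->; exists (S n); intros M HM a' Ha; apply Ha; lia.
  - intros [H1 H2].
    refine (eventually_impl _ _ _
      (eventually_and _ _ (IHc1 _ _ H1) (IHc2 _ _ H2))).
    intros M [K1 K2]; auto.
  - intros [k [H1 H2]].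
    refine (eventually_impl _ _ _
      (eventually_and _ _ (IHc2 _ _ H1) (IHc1 _ _ H2))).
    intros M [K1 K2] a' Ha; exists k; auto.
  - revert m; induction (nright n) as [|k IH]; intros m.
    + apply IHc1.
    + intros [z [H1 H2]].
      refine (eventually_impl _ _ _
        (eventually_and _ _ (IH _ H1) (IHc2 _ _ H2))).
      intros M [K1 K2] a' Ha; exists z; split; [apply K1 | apply K2]; assumption.
  - intros [H1 H2].
    assert (H3 : eventually (fun M => forall k, k < m ->
      forall a', agree M a a' -> exists v, eval a' c (npair n k) (S v))).
    { apply eventually_forall_lt; intros k Hk.
      destruct (H2 k Hk) as [v Hv].
      refine (eventually_impl _ _ _ (IHc _ _ Hv)).
      intros M K a' Ha; exists v; auto. }
    refine (eventually_impl _ _ _ (eventually_and _ _ (IHc _ _ H1) H3)).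
    intros M [K1 K2] a' Ha; split; auto.
Qed.

Lemma eval_functional (a : Baire) (c : code) (n m m' : nat) :
  eval a c n m -> eval a c n m' -> m = m'.
Proof.
  revert n m m'; induction c; intros n m m'; simpl; try congruence.
  - intros [H1 H2] [K1 K2].
    (* Pairing is bijective, so the two projections determine the output. *)
    rewrite <- (Cantor.cancel_to_of m), <- (Cantor.cancel_to_of m').
    f_equal.
    rewrite (surjective_pairing (Cantor.of_nat m)).
    rewrite (surjective_pairing (Cantor.of_nat m')).
    f_equal; [eapply IHc1 | eapply IHc2]; eassumption.
  - intros [k [H1 H2]] [k' [K1 K2]].
    assert (k = k') by eauto; subst k'; eauto.
  - revert m m'; induction (nright n) as [|k IH]; intros m m'.
    + apply IHc1.
    + intros [z [H1 H2]] [z' [K1 K2]].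
      assert (z = z') by eauto; subst z'; eauto.
  - intros [H1 H2] [K1 K2].
    destruct (lt_eq_lt_dec m m') as [[Hlt|He]|Hlt]; auto; exfalso.
    + destruct (K2 _ Hlt) as [v Hv]; discriminate (IHc _ _ _ H1 Hv).
    + destruct (H2 _ Hlt) as [v Hv]; discriminate (IHc _ _ _ K1 Hv).
Qed.

Lemma computes_continuous (c : code) (a b : Baire) (N : nat) :
  computes c a b ->
  eventually (fun M =>
    forall a' b', agree M a a' -> computes c a' b' -> agree N b b').
Proof.
  intros H.
  assert (K : eventually (fun M => forall n, n < N ->
    forall a', agree M a a' -> eval a' c n (b n))).
  { apply eventually_forall_lt; intros n _; apply eval_continuous, H. }
  refine (eventually_impl _ _ _ K).
  intros M HM a' b' Ha Hb n Hn.
  exact (eval_functional _ _ _ _ _ (HM n Hn a' Ha) (Hb n)).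
Qed.

(** * Finite agreement under pairing, and computable perturbations of zero *)

Lemma agree_bcons (N t : nat) (a b : Baire) :
  agree N a b -> agree N (bcons t a) (bcons t b).
Proof. intros H [|n] Hn; simpl; auto; apply H; lia. Qed.

Lemma agree_bjoin (N : nat) (a b a' b' : Baire) :
  agree N a a' -> agree N b b' -> agree N (bjoin a b) (bjoin a' b').
Proof.
  intros H K n Hn; unfold bjoin.
  assert (Nat.div2 n <= n) by 
      (rewrite Nat.div2_div; apply Nat.Div0.div_le_upper_bound; lia).
  destruct (Nat.even n); [apply H | apply K]; lia.
Qed.

Lemma agree_bjoin_left (N : nat) (a b a' b' : Baire) :
  agree (2 * N) (bjoin a b) (bjoin a' b') -> agree N a a'.
Proof.
  intros H n Hn.
  assert (K : bjoin a b (2 * n) = bjoin a' b' (2 * n)) by (apply H; lia).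
  unfold bjoin in K.
  now rewrite Nat.even_mul, Nat.div2_double in K.
Qed.

Lemma nleft_npair (n m : nat) : nleft (npair n m) = n.
Proof. unfold nleft, npair; now rewrite Cantor.cancel_of_to. Qed.

Lemma nright_npair (n m : nat) : nright (npair n m) = m.
Proof. unfold nright, npair; now rewrite Cantor.cancel_of_to. Qed.

Lemma nright_nleft_le (p : nat) : nright p + nleft p <= p.
Proof.
  unfold nleft, nright.
  pose proof (Cantor.to_nat_non_decreasing
    (fst (Cantor.of_nat p)) (snd (Cantor.of_nat p))) as H.
  now rewrite <- surjective_pairing, Cantor.cancel_to_of in H.
Qed.

Fixpoint ccst (t : nat) : code :=
  match t with 0 => czero | S t => ccomp csucc (ccst t) end.

Lemma eval_ccst (a : Baire) (t n : nat) : eval a (ccst t) n t.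
Proof. induction t; simpl; eauto. Qed.

Lemma computable_bcons (t : nat) (a : Baire) :
  computable a -> computable (bcons t a).
Proof.
  intros [c Hc].
  (* Primitive recursion serves as a case distinction: the step discards the previous value and runs
     [c] on the predecessor. The inner [cpair cleft cright] is the identity. *)
  exists (ccomp (cprec (ccst t) (ccomp c (ccomp cleft cright)))
                (cpair czero (cpair cleft cright))).
  intros n; exists (npair 0 n); cbn [eval].
  rewrite !nleft_npair, !nright_npair; repeat split.
  induction n as [|n IH].
  - apply eval_ccst.
  - exists (bcons t a n); split; [exact IH|].
    exists n; split; [|apply Hc].
    exists (npair n (bcons t a n)).
    now rewrite nright_npair, nleft_npair.
Qed.

Definition spike (s : nat) : Baire := fun n => if n =? s then 1 else 0.

Lemma computable_ext (a b : Baire) :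
  (forall n, a n = b n) -> computable a -> computable b.
Proof. intros H [c Hc]; exists c; intros n; rewrite <- H; apply Hc. Qed.

Lemma computable_zeros : computable zeros.
Proof. now exists czero. Qed.

Lemma computable_spike (s : nat) : computable (spike s).
Proof.
  induction s as [|s IH].
  - refine (computable_ext _ _ _ (computable_bcons 1 _ computable_zeros)).
    now intros [|n].
  - refine (computable_ext _ _ _ (computable_bcons 0 _ IH)).
    now intros [|n].
Qed.

Lemma agree_spike (s : nat) : agree s zeros (spike s).
Proof.
  intros n Hn; unfold spike, zeros.
  destruct (Nat.eqb_spec n s); lia.
Qed.

Lemma bjoin_spike_l (s n : nat) : bjoin (spike s) zeros n = spike (2 * s) n.
Proof.
  unfold bjoin, spike, zeros.
  destruct (Nat.even n) eqn:E.
  - apply Nat.even_spec in E; destruct E as [k ->].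
    rewrite Nat.div2_double.
    destruct (Nat.eqb_spec k s), (Nat.eqb_spec (2 * k) (2 * s)); lia.
  - destruct (Nat.eqb_spec n (2 * s)) as [->|]; auto.
    now rewrite Nat.even_mul in E.
Qed.

Lemma bjoin_spike_r (s n : nat) : bjoin zeros (spike s) n = spike (2 * s + 1) n.
Proof.
  unfold bjoin, spike, zeros.
  destruct (Nat.even n) eqn:E.
  - destruct (Nat.eqb_spec n (2 * s + 1)) as [->|]; auto.
    rewrite Nat.add_1_r, Nat.even_succ, Nat.odd_mul in E; discriminate.
  - assert (O : Nat.odd n = true) by (unfold Nat.odd; now rewrite E).
    apply Nat.odd_spec in O; destruct O as [k ->].
    rewrite Nat.add_1_r, Nat.div2_succ_double.
    destruct (Nat.eqb_spec k s), (Nat.eqb_spec (S (2 * k)) (2 * s + 1)); lia.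
Qed.

(** * Witnesses of the disjunction *)

Definition or_tuple (x0 x1 : Baire) : tuple [Fun; Fun] := (x0, (x1, tt)).

(** A witness of the matrix is the encoded tuple of all its variables, so after the answer [i] the
    component at [t] must spell out [(t, i, x)]. *)
Definition or_witness (i : nat) (x : tuple [Fun; Fun]) : Baire :=
  bcons i (fun p => @encode [Num; Num; Fun; Fun] (nleft p, (i, x)) (nright p)).

Lemma witness_or_forall_l (x1 : Baire) :
  witness or_forall (or_witness 0 (or_tuple zeros x1)) (or_tuple zeros x1).
Proof.
  intros t; split.
  - intros n; unfold bproj, btail, or_witness; cbn [bcons].
    now rewrite nleft_npair, nright_npair.
  - left; now split.
Qed.

Lemma witness_or_forall_r (x0 : Baire) :
  witness or_forall (or_witness 1 (or_tuple x0 zeros)) (or_tuple x0 zeros).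
Proof.
  intros t; split.
  - intros n; unfold bproj, btail, or_witness; cbn [bcons].
    now rewrite nleft_npair, nright_npair.
  - right; now split.
Qed.

Lemma witness_or_forall_head (a x0 x1 : Baire) :
  witness or_forall a (or_tuple x0 x1) ->
  (bhead a = 0 /\ forall t, x0 t = 0) \/ (bhead a = 1 /\ forall t, x1 t = 0).
Proof.
  intros H.
  assert (K : forall t, (bhead a = 0 /\ x0 t = 0) \/ (bhead a = 1 /\ x1 t = 0))
    by (intros t; exact (proj2 (H t))).
  destruct (K 0) as [[E _]|[E _]]; [left | right]; split; auto;
    intros t; destruct (K t) as [[E' Ht]|[E' Ht]]; congruence.
Qed.

(** Entry [p] of the body reads position [nright p <= p] of an encoding in which [x] is only shifted
    to the right. *)
Lemma agree_or_witness (N i : nat) (x x' : tuple [Fun; Fun]) :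
  agree N (encode x) (encode x') -> agree N (or_witness i x) (or_witness i x').
Proof.
  intros H; apply agree_bcons; intros p Hp.
  pose proof (nright_nleft_le p).
  assert (K : agree N (@encode [Num; Num; Fun; Fun] (nleft p, (i, x)))
                      (@encode [Num; Num; Fun; Fun] (nleft p, (i, x'))))
    by (cbn; now repeat apply agree_bcons).
  apply K; lia.
Qed.

(** * Witnesses of the target formula as a threshold with a Skolem function *)

Definition skolem_witness (m : nat) (L : nat -> nat -> nat) (y : Baire) : Baire :=
  bcons m (fun p =>
    let n := nleft p in let k := nleft (nright p) in
    bcons (L n k)
      (@encode [Num; Num; Num; Fun] (L n k, (k, (n, (y, tt)))))
      (nright (nright p))).

Lemma witness_skolem (m : nat) (L : nat -> nat -> nat) (y : Baire) :
  (forall n k, m <= n -> y (npair n (npair k (L n k))) = 0) ->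
  witness allinf_forall_exists (skolem_witness m L y) (y, tt).
Proof.
  intros H n Hn k.
  assert (E : forall j,
    bproj (bproj (btail (skolem_witness m L y)) n) k j =
    bcons (L n k) (@encode [Num; Num; Num; Fun] (L n k, (k, (n, (y, tt))))) j).
  { intros j; unfold bproj, btail, skolem_witness; cbn [bcons].
    now rewrite nright_npair, nleft_npair, nright_npair, nleft_npair. }
  set (b := bproj (bproj (btail (skolem_witness m L y)) n) k) in E.
  change ((forall j, btail b j =
             @encode [Num; Num; Num; Fun] (bhead b, (k, (n, (y, tt)))) j) /\
          y (npair n (npair k (bhead b))) = 0).
  replace (bhead b) with (L n k) by (symmetry; exact (E 0)); split.
  - intros j; exact (E (S j)).
  - exact (H n k Hn).
Qed.

Definition skolem_of (b : Baire) (n k : nat) : nat :=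
  bhead (bproj (bproj (btail b) n) k).

Lemma skolem_of_witness (b y : Baire) (n k : nat) :
  witness allinf_forall_exists b (y, tt) -> bhead b <= n ->
  y (npair n (npair k (skolem_of b n k))) = 0.
Proof. intros H Hn; exact (proj2 (H n Hn k)). Qed.

Lemma agree_skolem_witness (N m : nat) (L L' : nat -> nat -> nat) (y y' : Baire) :
  agree N y y' -> (forall n k, n < N -> k < N -> L n k = L' n k) ->
  agree N (skolem_witness m L y) (skolem_witness m L' y').
Proof.
  intros Hy HL; apply agree_bcons; intros p Hp; cbv zeta.
  pose proof (nright_nleft_le p); pose proof (nright_nleft_le (nright p)).
  rewrite <- HL by lia.
  assert (K : forall l k n, agree N
    (bcons l (@encode [Num; Num; Num; Fun] (l, (k, (n, (y, tt))))))
    (bcons l (@encode [Num; Num; Num; Fun] (l, (k, (n, (y', tt)))))))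
    by (intros; cbn; repeat apply agree_bcons; now apply agree_bjoin).
  apply K; lia.
Qed.

(** The first [N] entries involve [L] only at [n, k < N], and its correctness there depends on
    finitely many values of [y]. Elsewhere [b] repairs [L] without raising the threshold above
    [m]. *)
Lemma skolem_witness_perturb (m : nat) (L : nat -> nat -> nat) (y : Baire) (N : nat) :
  (forall n k, m <= n -> y (npair n (npair k (L n k))) = 0) ->
  eventually (fun M => forall y' b, agree M y y' ->
    witness allinf_forall_exists b (y', tt) -> bhead b <= m ->
    exists L', witness allinf_forall_exists (skolem_witness m L' y') (y', tt) /\
      agree N (skolem_witness m L y) (skolem_witness m L' y')).
Proof.
  intros HL.
  assert (E : eventually (fun M => forall n, n < N -> forall k, k < N ->
    npair n (npair k (L n k)) < M)).
  { apply eventually_forall_lt; intros n _.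
    apply eventually_forall_lt; intros k _.
    apply (eventually_ge (S _)). }
  refine (eventually_impl _ _ _ (eventually_and _ _ (eventually_ge N) E)).
  intros M [HN HM] y' b Hy Hb Hm.
  (* Keep [L] wherever it is still correct for [y'], and use [b] elsewhere. *)
  exists (fun n k =>
    if n <? m then L n k else
    if y' (npair n (npair k (L n k))) =? 0 then L n k else skolem_of b n k).
  split.
  - apply witness_skolem; intros n k Hn.
    destruct (Nat.ltb_spec n m); [lia|].
    destruct (Nat.eqb_spec (y' (npair n (npair k (L n k)))) 0); [assumption|].
    apply skolem_of_witness; [assumption | lia].
  - apply agree_skolem_witness.
    + intros n Hn; apply Hy; lia.
    + intros n k Hn Hk.
      destruct (Nat.ltb_spec n m); [reflexivity|].
      (* Here [y'] still has the value of [y] at the tested position, namely 0, so the old choice is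
         kept. *)
      now rewrite <- Hy, HL by auto.
Qed.

(** * Stability of the answer under perturbation *)

Definition reduces_at (eta rminus rplus : code) (x : tuple [Fun; Fun])
    (y : Baire) : Prop :=
  computes eta (encode x) (@encode [Fun] (y, tt)) /\
  (forall a, witness or_forall a x ->
     exists b, computes rminus (bjoin a (encode x)) b /\
       witness allinf_forall_exists b (y, tt)) /\
  (forall a, witness allinf_forall_exists a (y, tt) ->
     exists b, computes rplus (bjoin a (encode x)) b /\ witness or_forall b x).

(** The index [j] is the answer that stays correct at [x']. It forces a threshold at most [m] for
    [y'], so a witness for [y'] can imitate the one already fed to [rplus]. *)
Lemma rplus_head_stable (eta rminus rplus : code) (x : tuple [Fun; Fun]) (y : Baire) (m j : nat)
    (L : nat -> nat -> nat) (b c : Baire) :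
  computes eta (encode x) (@encode [Fun] (y, tt)) ->
  computes rminus (bjoin (or_witness j x) (encode x)) b -> bhead b <= m ->
  (forall n k, m <= n -> y (npair n (npair k (L n k))) = 0) ->
  computes rplus (bjoin (skolem_witness m L y) (encode x)) c ->
  eventually (fun s => forall x' y', agree s (encode x) (encode x') ->
    reduces_at eta rminus rplus x' y' -> witness or_forall (or_witness j x') x' ->
    exists c', witness or_forall c' x' /\ bhead c' = bhead c).
Proof.
  intros Heta Hb Hm HL Hc.
  destruct (computes_continuous _ _ _ 1 Hc) as [N HN].
  destruct (skolem_witness_perturb m L y N HL) as [B HB].
  (* [rplus] also reads the instance, hence [N]; [y] occupies the even positions of its encoding,
     hence [2 * B]; only the threshold output by [rminus] matters, hence 1. *)
  refine (eventually_impl _ _ _ (eventually_and _ _ (eventually_ge N)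
    (eventually_and _ _ (computes_continuous _ _ _ (2 * B) Heta)
      (computes_continuous _ _ _ 1 Hb)))).
  intros s [Hs [Es Rs]] x' y' Hx (Heta' & Hminus & Hplus) Hw.
  assert (Hy : agree B y y').
  { eapply agree_bjoin_left, (Es _ _ Hx), Heta'. }
  destruct (Hminus _ Hw) as (b' & Hb' & Wb').
  assert (Hm' : bhead b' <= m).
  { unfold bhead in *; rewrite <- (Rs (bjoin (or_witness j x') (encode x')) b'); auto.
    now apply agree_bjoin; [apply agree_or_witness|]. }
  destruct (HB B (le_n B) y' b' Hy Wb' Hm') as (L' & WL' & HL').
  destruct (Hplus _ WL') as (c' & Hc' & Wc').
  exists c'; split; auto.
  symmetry; refine (HN N (le_n N) _ _ _ Hc' 0 _); [|lia].
  apply agree_bjoin; auto.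
  intros n Hn; apply Hx; lia.
Qed.

(** * The perturbed instances and the contradiction *)

Lemma instance_spike_l (s : nat) : is_instance (or_tuple (spike s) zeros).
Proof.
  refine (computable_ext _ _ _ (computable_spike (2 * s))).
  intros n; rewrite <- bjoin_spike_l; cbn; unfold bjoin.
  now destruct (Nat.even n), (Nat.even (Nat.div2 n)).
Qed.

Lemma instance_spike_r (s : nat) : is_instance (or_tuple zeros (spike s)).
Proof.
  (* The second component is joined with the zero tail first, moving its spike to [2 * s], and then
     placed at odd positions. *)
  refine (computable_ext _ _ _ (computable_spike (2 * (2 * s) + 1))).
  intros n; rewrite <- bjoin_spike_r.
  change (bjoin zeros (spike (2 * s)) n =
          bjoin zeros (bjoin (spike s) zeros) n).
  unfold bjoin at 1 2; now rewrite <- bjoin_spike_l.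
Qed.

Lemma instance_zeros : is_instance (or_tuple zeros zeros).
Proof.
  refine (computable_ext _ _ _ computable_zeros).
  intros n; cbn; unfold bjoin.
  now destruct (Nat.even n), (Nat.even (Nat.div2 n)).
Qed.

Lemma spike_neq_zeros (s : nat) : ~ forall t, spike s t = 0.
Proof.
  intros H; specialize (H s); unfold spike in H.
  now rewrite Nat.eqb_refl in H.
Qed.

Theorem proposition4p10 : ~ le_m or_forall allinf_forall_exists.
Proof.
  intros (eta & rminus & rplus & H).
  assert (R : forall x, is_instance x -> exists y, reduces_at eta rminus rplus x y).
  { intros x Hx; destruct (H x Hx) as ([y []] & _ & Heta & _ & Hm & Hp).
    now exists y. }
  destruct (R _ instance_zeros) as (y & Heta & Hminus & Hplus).
  destruct (Hminus _ (witness_or_forall_l zeros)) as (b0 & Hb0 & Wb0).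
  destruct (Hminus _ (witness_or_forall_r zeros)) as (b1 & Hb1 & Wb1).
  (* The maximum covers both cases, since the answer of [rplus], and hence the component to spoil,
     is not yet known. *)
  set (m := Nat.max (bhead b0) (bhead b1)).
  assert (HL : forall n k, m <= n ->
    y (npair n (npair k (skolem_of b0 n k))) = 0).
  { intros n k Hn; apply skolem_of_witness; [assumption | lia]. }
  destruct (Hplus _ (witness_skolem _ _ _ HL)) as (c & Hc & Wc).
  destruct (witness_or_forall_head _ _ _ Wc) as [[E _]|[E _]].
  (* The answer was 0, so the first component is spoiled. Answer 1 survives, and [b1] controls the
     threshold. *)
  - destruct (rplus_head_stable _ _ _ _ _ m _ _ _ _ Heta Hb1 ltac:(lia) HL Hc)
      as [s Hs].
    destruct (R _ (instance_spike_l s)) as (y' & Ry').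
    destruct (Hs s (le_n s) (or_tuple (spike s) zeros) y') as (c' & Wc' & Ec').
    + apply agree_bjoin; [apply agree_spike | easy].
    + assumption.
    + apply witness_or_forall_r.
    + destruct (witness_or_forall_head _ _ _ Wc') as [[_ Z]|[E' _]].
      * exact (spike_neq_zeros s Z).
      * congruence.
  (* Symmetrically, after answer 1 the second component is spoiled and [b0] controls the
     threshold. *)
  - destruct (rplus_head_stable _ _ _ _ _ m _ _ _ _ Heta Hb0 ltac:(lia) HL Hc)
      as [s Hs].
    destruct (R _ (instance_spike_r s)) as (y' & Ry').
    destruct (Hs s (le_n s) (or_tuple zeros (spike s)) y') as (c' & Wc' & Ec').
    + apply agree_bjoin; [easy | apply agree_bjoin; [apply agree_spike | easy]].
    + assumption.
    + apply witness_or_forall_l.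
    + destruct (witness_or_forall_head _ _ _ Wc') as [[E' _]|[_ Z]].
      * congruence.
      * exact (spike_neq_zeros s Z).
Qed.
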